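(* Let $X$ be a real Banach space and $k\in\mathbb{Z}^+$. If $X$ is $k$-WLUR, then every proximinal convex subset of $X$ is $k$-$w$SCh on $X$.
   Context: $S_X$ is the unit sphere of $X$; $X^*$ is the dual. For $x_1,\dots,x_{k+1}\in X$ and $f_1,\dots,f_k\in X^*$, $D_k[(x_i)_{i=1}^{k+1};(f_j)_{j=1}^{k}]$ denotes the determinant of the $(k+1)\times(k+1)$ matrix whose first row consists of ones and whose $(j+1,i)$ entry is $f_j(x_i)$. $X$ is $k$-weakly locally uniformly rotund ($k$-WLUR) if for every $x\in S_X$, $\epsilon>0$ and $f_1,\dots,f_k\in S_{X^*}$, $$\inf\Big(\{1\}\cup\Big\{1-\tfrac{1}{k+1}\Big\|x+\sum_{i=1}^{k}x_i\Big\| : x_1,\dots,x_{k}\in S_X,\ |D_k[x,(x_i)_{i=1}^{k};(f_j)_{j=1}^{k}]|\ge\epsilon\Big\}\Big)>0.$$ For a non-empty $A\subseteq X$, $x\in X$, $\delta>0$: $d(x,A)=\inf\{\|x-y\|:y\in A\}$ and $P_A(x,\delta)=\{y\in A:\|x-y\|\le d(x,A)+\delta\}$. $A$ is proximinal at $x$ if there is $y\in A$ with $\|x-y\|=d(x,A)$, and proximinal if it is proximinal at every $x\in X$. $A$ is $k$-weakly strongly Chebyshev ($k$-$w$SCh) at $x$ if $A$ is proximinal at $x$ and for every $\epsilon>0$ and $f_1,\dots,f_k\in S_{X^*}$ there exists $\delta>0$ such that $|D_k[(x_i)_{i=1}^{k+1};(f_j)_{j=1}^{k}]|\le\epsilon$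 whenever $x_1,\dots,x_{k+1}\in P_A(x,\delta)$. $A$ is $k$-$w$SCh on $B\subseteq X$ if it is $k$-$w$SCh at every $x\in B$. *)

(* Defs.v *)
From HB Require Import structures.
From mathcomp Require Import all_boot all_order all_algebra.
From mathcomp Require Import all_classical all_reals all_analysis.

Set Implicit Arguments.
Unset Strict Implicit.
Unset Printing Implicit Defensive.

Import Order.TTheory GRing.Theory Num.Theory.
Import numFieldNormedType.Exports.

Local Open Scope classical_set_scope.
Local Open Scope ring_scope.

Definition unit_sphere (R : realType) (X : normedModType R) : set X :=
  [set x | `|x| = 1].

(* The real-valued [sup] is 0 on an unbounded set, so this is the dual norm
   only for continuous f. *)
Definition dual_norm (R : realType) (X : normedModType R)
    (f : {linear X -> R^o}) : R :=
  sup [set `|f x| | x in [set x : X | `|x| <= 1]].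

Definition dual_unit_sphere (R : realType) (X : normedModType R) :
    set {linear X -> R^o} :=
  [set f : {linear X -> R^o} | continuous f /\ dual_norm f = 1].

(* [ocons x y] is the (k+1)-family (x, y_0, ..., y_(k-1)). *)
Definition ocons (T : Type) (k : nat) (x : T) (y : 'I_k -> T) (i : 'I_k.+1) : T :=
  if unlift ord0 i is Some j then y j else x.

Definition detD (R : realType) (X : normedModType R) (k : nat)
    (x : 'I_k.+1 -> X) (f : 'I_k -> {linear X -> R^o}) : R :=
  \det (\matrix_(j < k.+1, i < k.+1)
          ocons (1 : R) (fun j' : 'I_k => f j' (x i) : R) j).

Definition kWLUR (R : realType) (k : nat) (X : normedModType R) : Prop :=
  forall (x : X) (e : R) (f : 'I_k -> {linear X -> R^o}),
    unit_sphere x -> 0 < e -> (forall j, dual_unit_sphere (f j)) ->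
    0 < inf ([set (1 : R)] `|`
             [set 1 - k.+1%:R^-1 * `|x + \sum_(i < k) y i| |
                y in [set y : 'I_k -> X |
                        (forall i, unit_sphere (y i)) /\
                        e <= `|detD (ocons x y) f| ]]).

Definition dist_to (R : realType) (X : normedModType R) (x : X) (A : set X) : R :=
  inf [set `|x - y| | y in A].

Definition near_proj (R : realType) (X : normedModType R) (A : set X) (x : X)
    (d : R) : set X :=
  [set y | A y /\ `|x - y| <= dist_to x A + d].

Definition proximinal_at (R : realType) (X : normedModType R) (A : set X)
    (x : X) : Prop :=
  exists y, A y /\ `|x - y| = dist_to x A.

Definition proximinal (R : realType) (X : normedModType R) (A : set X) : Prop :=
  forall x, proximinal_at A x.

Definition kwSCh_at (R : realType) (k : nat) (X : normedModType R) (A : set X)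
    (x : X) : Prop :=
  proximinal_at A x /\
  forall (e : R) (f : 'I_k -> {linear X -> R^o}),
    0 < e -> (forall j, dual_unit_sphere (f j)) ->
    exists d : R, 0 < d /\
      forall y : 'I_k.+1 -> X,
        (forall i, near_proj A x d (y i)) -> `|detD y f| <= e.

Definition kwSCh_on (R : realType) (k : nat) (X : normedModType R) (A B : set X) :
    Prop :=
  forall x, B x -> kwSCh_at k A x.

(* Main.v *)
Require Import Defs.
From HB Require Import structures.
From mathcomp Require Import all_boot all_order all_algebra.
From mathcomp Require Import all_classical all_reals all_analysis.
From mathcomp Require Import perm ring lra.

Set Implicit Arguments.
Unset Strict Implicit.
Unset Printing Implicit Defensive.

Import Order.TTheory GRing.Theory Num.Theory.
Import numFieldNormedType.Exports.

Local Open Scope classical_set_scope.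
Local Open Scope ring_scope.

(** Let d = d(x, A) and let p be a nearest point of x.  If d = 0, then
  P_A(x, h) lies in the ball of radius h about x and D_k is small there by
  continuity.  If d > 0, take y_1, ..., y_k in P_A(x, h): the mean of
  p, y_1, ..., y_k lies in A, hence is at distance at least d from x, so the
  normalized vectors u, v_1, ..., v_k of p - x, y_i - x satisfy
  |u + sum v_i| >= (k + 1) - k h / d, and k-WLUR at u makes D_k[u, (v_i)]
  small.  By affine homogeneity and continuity of D_k, D_k[p, (y_i)] is small.
  Finally D_k of k + 1 points of P_A(x, h) is an alternating sum of k + 1
  values of D_k with one point replaced by p. *)

(** * Perturbation bounds for products and determinants *)

(** Factors are exchanged one at a time, by induction. The hypothesis [1 <= c] absorbs the surplus
    power in [c ^+ n], which avoids a predecessor in the exponent. *)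
Lemma ler_norm_prodB (R : realDomainType) (n : nat) (a b : 'I_n -> R) (c h : R) :
  1 <= c -> (forall i, `|a i| <= c) -> (forall i, `|b i| <= c) ->
  (forall i, `|a i - b i| <= h) ->
  `|\prod_i a i - \prod_i b i| <= n%:R * c ^+ n * h.
Proof.
move=> c1; have c0 : 0 <= c by exact: le_trans c1.
elim: n a b => [|n IHn] a b ac bc abh.
  by rewrite !big_ord0 subrr normr0 !mul0r.
rewrite !big_ord_recl.
set p := \prod_(i < n) a _; set q := \prod_(i < n) b _.
have h0 : 0 <= h by exact: le_trans (abh ord0).
have pc : `|p| <= c ^+ n.
  rewrite normr_prod -[n in leRHS]card_ord -prodr_const.
  by apply: ler_prod => i _; rewrite normr_ge0 ac.
have pq : `|p - q| <= n%:R * c ^+ n * h by apply: IHn => i.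
have -> : a ord0 * p - b ord0 * q = (a ord0 - b ord0) * p + b ord0 * (p - q).
  by rewrite mulrBl mulrBr addrA subrK.
apply: le_trans (ler_normD _ _) _; rewrite !normrM.
have -> : n.+1%:R * c ^+ n.+1 * h
    = h * (c ^+ n * c) + c * (n%:R * c ^+ n * h).
  by rewrite -natr1 exprSr; ring.
apply: lerD; apply: ler_pM => //.
by apply: le_trans pc _; rewrite ler_peMr// exprn_ge0.
Qed.

Lemma ler_norm_detB (R : realDomainType) (n : nat) (A B : 'M[R]_n) (c h : R) :
  1 <= c -> (forall i j, `|A i j| <= c) -> (forall i j, `|B i j| <= c) ->
  (forall i j, `|A i j - B i j| <= h) ->
  `|\det A - \det B| <= n`!%:R * (n%:R * c ^+ n * h).
Proof.
move=> c1 Ac Bc ABh; rewrite -sumrB; apply: le_trans (ler_norm_sum _ _ _) _.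
rewrite -card_Sn mulr_natl -sumr_const.
apply: ler_sum => s _.
by rewrite -mulrBr normrM normr_sign mul1r ler_norm_prodB.
Qed.

(** * Continuity, affine homogeneity and cone inequality for D_k *)

Section DetD.
Variables (R : realType) (X : normedModType R).
Implicit Types f : {linear X -> R^o}.

Lemma ocons0 (T : Type) (k : nat) (x : T) (y : 'I_k -> T) : ocons x y ord0 = x.
Proof. by rewrite /ocons unlift_none. Qed.

Lemma ocons_lift (T : Type) (k : nat) (x : T) (y : 'I_k -> T) (j : 'I_k) :
  ocons x y (lift ord0 j) = y j.
Proof. by rewrite /ocons liftK. Qed.

Lemma ler_norm_dual_unit_sphere f x : dual_unit_sphere f -> `|f x| <= `|x|.
Proof.
move=> [_ f1].
set E := [set `|f x| | x in [set x : X | `|x| <= 1]] in f1.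
(* [sup] defaults to 0 on a set without supremum, so the value 1 forces boundedness. *)
have Esup : has_sup E.
  apply: contrapT => /sup_out E0; move: f1; rewrite /dual_norm -/E E0.
  by move/eqP; rewrite eq_sym oner_eq0.
have [->|x0] := eqVneq x 0; first by rewrite linear0 !normr0.
have nx : 0 < `|x| by rewrite normr_gt0.
have : `|f (`|x|^-1 *: x)| <= 1.
  rewrite -f1; apply: ub_le_sup; first exact: Esup.2.
  by exists (`|x|^-1 *: x) => //=; rewrite normrZ normfV normr_id mulVf ?gt_eqF.
by rewrite linearZ normrZ normfV normr_id mulrC ler_pdivrMr// mul1r.
Qed.

Lemma ler_norm_detDB (k : nat) (f : 'I_k -> {linear X -> R^o})
    (y z : 'I_k.+1 -> X) (c h : R) :
  (forall j x, `|f j x| <= `|x|) -> 1 <= c ->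
  (forall i, `|y i| <= c) -> (forall i, `|z i| <= c) ->
  (forall i, `|y i - z i| <= h) ->
  `|detD y f - detD z f| <= k.+1`!%:R * (k.+1%:R * c ^+ k.+1 * h).
Proof.
move=> f1 c1 yc zc yzh; apply: ler_norm_detB => // i j; rewrite !mxE /ocons;
  case: unliftP => [l _|_]; rewrite ?normr1 //.
- exact: le_trans (yc j).
- exact: le_trans (zc j).
- by rewrite -linearB; exact: le_trans (yzh j).
- by rewrite subrr normr0 (le_trans _ (yzh j)).
Qed.

(** Left multiplication by the block triangular [E] scales each functional row by [a] and adds
    [f j x] times the row of ones to it. *)
Lemma detD_affine (k : nat) (f : 'I_k -> {linear X -> R^o})
    (y : 'I_k.+1 -> X) (x : X) (a : R) :
  detD (fun i => x + a *: y i) f = a ^+ k * detD y f.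
Proof.
pose E : 'M[R]_(1 + k) := block_mx 1 0 (\col_j (f j x : R)) a%:M.
have dE : \det E = a ^+ k by rewrite det_lblock det1 mul1r det_scalar.
have rs (l : 'I_k) : lift ord0 l = rshift 1 l :> 'I_(1 + k) by exact/val_inj.
have l0 : ord0 = lshift k ord0 :> 'I_(1 + k) by exact/val_inj.
have Eul : E ord0 ord0 = 1 by rewrite /E l0 block_mxEul mxE.
have Eur m : E ord0 (lift ord0 m) = 0 by rewrite /E rs l0 block_mxEur mxE.
have Edl l : E (lift ord0 l) ord0 = f l x by rewrite /E rs l0 block_mxEdl mxE.
have Edr l m : E (lift ord0 l) (lift ord0 m) = a *+ (l == m).
  by rewrite /E !rs block_mxEdr mxE.
clearbody E.
rewrite /detD -dE -det_mulmx; congr (\det _).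
apply/matrixP => i j; rewrite !mxE.
rewrite big_ord_recl !mxE ocons0 mulr1.
under eq_bigr do rewrite !mxE ocons_lift.
case: (unliftP ord0 i) => [l ->|->].
  rewrite ocons_lift Edl linearD linearZ (bigD1 l)//= Edr eqxx mulr1n.
  by rewrite big1 ?addr0// => m ml; rewrite Edr eq_sym (negbTE ml) mul0r.
by rewrite ocons0 Eul big1 ?addr0// => m _; rewrite Eur mul0r.
Qed.

(** For [0 < k] the matrix has two equal columns; for [k = 0] the determinant would be 1. *)
Lemma detD_const (k : nat) (f : 'I_k -> {linear X -> R^o}) (x : X) :
  (0 < k)%N -> detD (fun=> x) f = 0.
Proof.
case: k f => // k f _; rewrite /detD -det_tr.
apply: (@determinant_alternate _ _ _ ord0 ord_max) => // i.
by rewrite !mxE.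
Qed.

(* Duplicating the row of ones in the matrix of (x, y_0, ..., y_k) makes it
   singular; expanding along that row expresses detD y by the faces at x. *)
Lemma ler_norm_detD_cone (k : nat) (f : 'I_k -> {linear X -> R^o})
    (x : X) (y : 'I_k.+1 -> X) :
  `|detD y f| <= \sum_(j < k.+1) `|detD (ocons x (y \o lift j)) f|.
Proof.
pose z := ocons x y.
pose P : 'M[R]_k.+2 := \matrix_(i, j)
  ocons 1 (ocons 1 (fun l : 'I_k => f l (z j) : R)) i.
have P0 : \det P = 0.
  apply: (@determinant_alternate _ _ _ ord0 (lift ord0 ord0)) => // j.
  by rewrite !mxE ocons_lift !ocons0.
have minorE j : \det (row' ord0 (col' j P)) = detD (z \o lift j) f.
  by congr (\det _); apply/matrixP => i l; rewrite !mxE ocons_lift.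
move: P0; rewrite (expand_det_row _ ord0) big_ord_recl.
rewrite mxE ocons0 mul1r /cofactor minorE addn0 expr0 mul1r.
have -> : detD (z \o lift ord0) f = detD y f.
  by congr (detD _ _); apply/funext => i /=; rewrite /z ocons_lift.
move/eqP; rewrite addr_eq0 => /eqP ->; rewrite normrN.
apply: le_trans (ler_norm_sum _ _ _) _; apply: ler_sum => j _.
rewrite mxE ocons0 mul1r normrM normrX normrN1 expr1n mul1r minorE.
(* Deleting a column other than the first leaves [x] in front. *)
rewrite (_ : z \o lift _ = ocons x (y \o lift j))//.
apply/funext => i; rewrite /z /=; case: (unliftP ord0 i) => [l ->|->].
  rewrite ocons_lift /= -(ocons_lift x y); congr (ocons _ _ _).
  by apply/val_inj; rewrite /= /bump /= !add1n ltnS addnS.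
rewrite ocons0 -[RHS](ocons0 x y); congr (ocons _ _ _).
exact/val_inj.
Qed.

End DetD.

(** * Means in convex sets, the rotundity gap and distances *)

(** By induction: the first point gets weight 1/(n+2), the mean of the others the remaining
    weight. *)
Lemma convex_set_mean (R : realFieldType) (M : lmodType R)
    (A : set (convex_lmodType M)) (n : nat) (y : 'I_n.+1 -> M) :
  convex_set A -> (forall i, A (y i)) -> A (n.+1%:R^-1 *: \sum_i y i).
Proof.
move=> cA; elim: n y => [|n IHn] y Ay.
  by rewrite big_ord1 invr1 scale1r.
have t0 : 0 <= n.+2%:R^-1 :> R by rewrite invr_ge0.
have t1 : n.+2%:R^-1 <= 1 :> R by rewrite invf_le1 ?ler1n.
have := cA (y ord0) (n.+1%:R^-1 *: \sum_(i < n.+1) y (lift ord0 i))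
  (Itv01 t0 t1).
rewrite !inE => /(_ (Ay _) (IHn _ (fun=> Ay _))).
rewrite [in X in _ -> X]big_ord_recl scalerDr; congr (A (_ + _)).
rewrite scalerA; congr (_ *: _).
transitivity ((1 - n.+2%:R^-1) / n.+1%:R : R) => //; rewrite -[n.+2%:R]natr1.
by field; rewrite !nat1r !natr1 !pnatr_eq0.
Qed.

(** Contrapositive form of k-WLUR, with the positive infimum itself as the margin [m]. *)
Lemma kWLUR_gap (R : realType) (X : normedModType R) (k : nat)
    (u : X) (e : R) (f : 'I_k -> {linear X -> R^o}) :
  kWLUR k X -> unit_sphere u -> 0 < e -> (forall j, dual_unit_sphere (f j)) ->
  exists2 m : R, 0 < m & forall v : 'I_k -> X, (forall i, unit_sphere (v i)) ->
    k.+1%:R * (1 - m) < `|u + \sum_i v i| -> `|detD (ocons u v) f| < e.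
Proof.
move=> hX u1 e0 f1; have := hX u e f u1 e0 f1.
set E := [set 1] `|` _ => m0; exists (inf E) => // v v1 uv.
(* [inf] defaults to 0 on a set without infimum, which positivity excludes. *)
have Einf : has_inf E.
  by apply: contrapT => /inf_out E0; rewrite E0 ltxx in m0.
rewrite ltNge; apply/negP => eD; move: uv; apply/negP; rewrite -leNgt.
have : inf E <= 1 - k.+1%:R^-1 * `|u + \sum_i v i|.
  by apply: ge_inf; [exact: Einf.2|right; exists v].
by rewrite lerBrDr addrC -lerBrDr mulrC ler_pdivrMr// mulrC.
Qed.

Lemma dist_to_le (R : realType) (X : normedModType R) (x y : X) (A : set X) :
  A y -> dist_to x A <= `|x - y|.
Proof.
move=> Ay; apply: ge_inf; last by exists y.
by exists 0 => _ [z _ <-].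
Qed.

Lemma norm_sub_near_proj (R : realType) (X : normedModType R) (A : set X)
    (x y : X) (d : R) :
  near_proj A x d y -> dist_to x A <= `|y - x| <= dist_to x A + d.
Proof. by move=> [Ay xy]; rewrite distrC dist_to_le. Qed.

(* kWLUR applies to the radial projections of the points onto the sphere about
   [x] of radius d(x, A); Lipschitz continuity of detD transfers the bound. *)
Lemma detD_near_proj (R : realType) (X : normedModType R) (k : nat) (A : set X)
    (x p : X) (e : R) (f : 'I_k -> {linear X -> R^o}) :
  kWLUR k X -> convex_set A -> A p -> `|p - x| = dist_to x A ->
  0 < dist_to x A -> 0 < e -> (forall j, dual_unit_sphere (f j)) ->
  exists2 h : R, 0 < h & forall y : 'I_k -> X,
    (forall i, near_proj A x h (y i)) -> `|detD (ocons p y) f| <= e.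
Proof.
set d := dist_to x A => hX cA Ap pd d0 e0 f1.
(* [c] bounds the norms of the points of [near_proj A x h] when [h <= 1]; [K] is a Lipschitz
   constant of [detD] on that ball. *)
pose c := `|x| + d + 1.
have c1 : 1 <= c by rewrite lerDr addr_ge0// ltW.
pose K := k.+1`!%:R * (k.+1%:R * c ^+ k.+1).
have K0 : 0 < K.
  by rewrite !mulr_gt0// ?ltr0n ?fact_gt0// exprn_gt0// (lt_le_trans _ c1).
have dk0 : 0 < d ^+ k by rewrite exprn_gt0.
pose u := d^-1 *: (p - x).
have pE : p = x + d *: u by rewrite scalerA divff ?gt_eqF// scale1r subrKC.
have du : d *: u = p - x by rewrite pE addrC addKr.
have u1 : unit_sphere u.
  by rewrite /unit_sphere /= normrZ pd normfV (gtr0_norm d0) mulVf ?gt_eqF.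
(* Half of [e] pays for replacing [y i] by its radial projection; the division by [d ^+ k]
   anticipates the factor from [detD_affine]. *)
have [m m0 gap] := kWLUR_gap (e := e / 2 / d ^+ k) hX u1
  ltac:(by rewrite !divr_gt0) f1.
(* The three terms keep the points in the ball of radius [c], bound the Lipschitz error by [e / 2],
   and make [h < m * d] strict. *)
pose h := Num.min 1 (Num.min (e / 2 / K) (m * d / 2)).
have h0 : 0 < h by rewrite !lt_min ltr01 !divr_gt0// mulr_gt0.
have h1 : h <= 1 by rewrite ge_min lexx.
have hK : K * h <= e / 2.
  by rewrite mulrC -ler_pdivlMr// !ge_min lexx orbT.
have hm : h < m * d.
  have md0 := mulr_gt0 m0 d0.
  by apply: (@le_lt_trans _ _ (m * d / 2)); [rewrite !ge_min lexx !orbT|lra].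
exists h => // y yh.
have yd i := norm_sub_near_proj (yh i); rewrite -/d in yd.
have y0 i : 0 < `|y i - x| by have /andP[+ _] := yd i; exact: lt_le_trans.
pose v i := `|y i - x|^-1 *: (y i - x).
have v1 i : unit_sphere (v i).
  by rewrite /unit_sphere /= normrZ normfV normr_id mulVf ?gt_eqF.
have yv i : `|y i - (x + d *: v i)| <= h.
  rewrite opprD addrA scalerA -{1}[y i - x]scale1r -scalerBl normrZ.
  rewrite -[X in _ * X]normr_id -normrM mulrBl mul1r mulfVK ?gt_eqF//.
  by have /andP[d1 d2] := yd i; rewrite ger0_norm ?subr_ge0// lerBlDl.
have yc i : `|y i| <= c.
  rewrite -[y i](subrKC x) (le_trans (ler_normD _ _))// /c -addrA lerD2l.
  by have /andP[_ /le_trans] := yd i; apply; rewrite lerD2l.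
have dc w : unit_sphere w -> `|x + d *: w| <= c.
  rewrite /unit_sphere /= => w1; rewrite (le_trans (ler_normD _ _))// normrZ w1.
  by rewrite mulr1 gtr0_norm// /c lerDl.
have Duv : `|detD (ocons u v) f| < e / 2 / d ^+ k.
  apply: gap => //; rewrite -(ltr_pM2l d0).
  pose q := ocons p y.
  have Aq i : A (q i).
    case: (unliftP ord0 i) => [j ->|->]; rewrite /q ?ocons0 ?ocons_lift//.
    by have [] := yh j.
  have := dist_to_le x (convex_set_mean cA Aq); rewrite -/d => dq.
  (* The error sum has only [k] terms, since [p] equals [x + d *: u] exactly. *)
  have qE : k.+1%:R *: (k.+1%:R^-1 *: (\sum_i q i) - x)
      = d *: (u + \sum_i v i) + \sum_i (y i - (x + d *: v i)).
    rewrite scalerBr scalerA divff ?pnatr_eq0// scale1r big_ord_recl /q ocons0.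
    under eq_bigr do rewrite ocons_lift.
    rewrite sumrB big_split/= sumr_const card_ord -scaler_sumr scaler_nat.
    rewrite scalerDr du mulrS !opprD [RHS]addrACA [X in _ = _ + X]addrCA subrr.
    by rewrite addr0 [LHS]addrA; congr (_ - _); exact: addrAC.
  have := congr1 Num.norm qE; rewrite normrZ normr_nat distrC => nq.
  have : k.+1%:R * d <= d * `|u + \sum_i v i| + k%:R * h.
    apply: le_trans (_ : k.+1%:R * `|x - k.+1%:R^-1 *: \sum_i q i| <= _).
      by rewrite ler_wpM2l.
    rewrite nq (le_trans (ler_normD _ _))// normrZ gtr0_norm// lerD2l.
    rewrite (le_trans (ler_norm_sum _ _ _))// mulr_natl.
    by rewrite -[k in _ *+ k]card_ord -sumr_const ler_sum.
  have kh : k%:R * h <= k.+1%:R * h by rewrite ler_wpM2r ?ler_nat// ltW.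
  have km : k.+1%:R * h < k.+1%:R * (m * d) by rewrite ltr_pM2l.
  by lra.
rewrite -[detD _ _](subrK (detD (fun i => x + d *: ocons u v i) f)).
rewrite (le_trans (ler_normD _ _))// (splitr e) lerD//.
  apply: le_trans hK; rewrite /K -mulrA.
  apply: ler_norm_detDB => //.
  - by move=> j z; exact: ler_norm_dual_unit_sphere.
  - move=> i; case: (unliftP ord0 i) => [j ->|->].
      by rewrite ocons_lift.
    by rewrite ocons0 pE dc.
  - move=> i; apply: dc; case: (unliftP ord0 i) => [j ->|->].
      by rewrite ocons_lift.
    by rewrite ocons0.
  - move=> i; case: (unliftP ord0 i) => [j ->|->].
      by rewrite !ocons_lift.
    by rewrite !ocons0 -pE subrr normr0 ltW.
rewrite detD_affine normrM gtr0_norm// -ler_pdivlMl// mulrC.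
exact: ltW.
Qed.

Theorem proposition3p19 (R : realType) (X : completeNormedModType R) (k : nat)
    (hk : (0 < k)%N) (hX : kWLUR k X) (A : set X) (hprox : proximinal A)
    (hconv : convex_set A) :
  kwSCh_on k A [set: X].
Proof.
move=> x _; split=> // e f e0 f1.
have [p [Ap xp]] := hprox x; rewrite distrC in xp.
have : 0 <= dist_to x A by rewrite -xp.
rewrite le_eqVlt => /predU1P[d0|d0].
  pose c := `|x| + 1.
  have c1 : 1 <= c by rewrite lerDr.
  pose K := k.+1`!%:R * (k.+1%:R * c ^+ k.+1).
  have K0 : 0 < K.
    by rewrite !mulr_gt0// ?ltr0n ?fact_gt0// exprn_gt0// (lt_le_trans _ c1).
  exists (Num.min 1 (e / K)); split; first by rewrite lt_min ltr01 divr_gt0.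
  set h := Num.min _ _; move=> y yh.
  have yx i : `|y i - x| <= h.
    by have /andP[_] := norm_sub_near_proj (yh i); rewrite -d0 add0r.
  (* Comparison with the constant family at [x], where D_k vanishes. *)
  rewrite -[detD y f]subr0 -(detD_const f x hk).
  apply: le_trans (_ : K * h <= e); last first.
    by rewrite mulrC -ler_pdivlMr// ge_min lexx orbT.
  rewrite /K -mulrA; apply: ler_norm_detDB => //.
  - by move=> j z; exact: ler_norm_dual_unit_sphere.
  - move=> i; rewrite -[y i](subrKC x) (le_trans (ler_normD _ _))// lerD2l.
    by rewrite (le_trans (yx i))// ge_min lexx.
  - by move=> i; rewrite lerDl.
(* The tolerance is [e / k.+1%:R] because the cone inequality sums [k.+1] faces. *)
have [h h0 yp] := detD_near_proj hX hconv Ap xp d0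
  (divr_gt0 e0 (ltr0Sn R k)) f1.
exists h; split=> // y yh; apply: le_trans (ler_norm_detD_cone f p y) _.
rewrite -[leRHS](divfK (_ : k.+1%:R != 0)) ?pnatr_eq0//.
rewrite mulr_natr -[X in _ *+ X]card_ord -sumr_const.
by apply: ler_sum => j _; apply: yp => i; exact: yh.
Qed.
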